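(* Let $R=\{(0,0),(0,1),(2,0),(2,1),(2,3),(3,0),(3,1),(3,3)\}$ and let $\mathrm{P}_3=(123,R)$ and $\mathrm{P}_4=(132,R)$ be mesh patterns. For every $n\ge 1$ and all integers $k,\ell\ge 0$, $$|\{\sigma\in\mathfrak{S}_n: \mathrm{P}_3(\sigma)=k,\ \mathrm{P}_4(\sigma)=\ell\}| = |\{\sigma\in\mathfrak{S}_n: \mathrm{P}_4(\sigma)=k,\ \mathrm{P}_3(\sigma)=\ell\}|.$$
   Context: $\mathfrak{S}_n$ is the set of permutations $\sigma=\sigma_1\sigma_2\cdots\sigma_n$ of $[n]=\{1,\dots,n\}$ in one-line notation. A mesh pattern is a pair $p=(\pi,R)$ with $\pi\in\mathfrak{S}_m$ and $R\subseteq\{0,\dots,m\}\times\{0,\dots,m\}$ (the set of shaded unit cells, each given by its bottom-left corner, in the grid with dots at $(i,\pi_i)$). An occurrence of $p$ in $\sigma\in\mathfrak{S}_n$ is a choice of indices $i_1<\cdots<i_m$ such that $\sigma_{i_1}\cdots\sigma_{i_m}$ is order-isomorphic to $\pi$ and, for every $(a,b)\in R$, there is no index $r$ with $i_a<r<i_{a+1}$ and $v_b<\sigma_r<v_{b+1}$; here $v_1<\cdots<v_m$ is the increasing rearrangement of $\sigma_{i_1},\dots,\sigma_{i_m}$, $i_0=v_0=0$ and $i_{m+1}=v_{m+1}=n+1$. $p(\sigma)$ denotes the number of occurrences of $p$ in $\sigma$. *)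

(* Defs.v *)
From mathcomp Require Import all_boot all_fingroup.

Set Implicit Arguments.
Unset Strict Implicit.
Unset Printing Implicit Defensive.

(* Permutations are elements of 'S_n, so positions and values are numbered from
   0: sigma_(i+1) is (s i).+1 for i : 'I_n.  Grid lines and shaded cells keep
   the usual numbering: the lines are 0, 1, ..., m + 1 and the cell (a, b) lies
   between the vertical lines a, a + 1 and the horizontal lines b, b + 1. *)
Record mesh_pattern (m : nat) : Type := MeshPattern {
  mesh_perm : 'S_m;
  mesh_shading : {set 'I_m.+1 * 'I_m.+1}
}.

Section Occurrences.

Variables (m n : nat) (p : mesh_pattern m) (s : 'S_n) (f : {ffun 'I_m -> 'I_n}).

(* The sequence i_0, i_1, ..., i_m, i_(m+1), with i_0 = 0, i_(m+1) = n + 1. *)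
Definition index_lines : seq nat :=
  0 :: rcons [seq (f j).+1 | j <- enum 'I_m] n.+1.

(* The sequence v_0, v_1, ..., v_m, v_(m+1), with v_0 = 0, v_(m+1) = n + 1. *)
Definition value_lines : seq nat :=
  0 :: rcons (sort leq [seq (s (f j)).+1 | j <- enum 'I_m]) n.+1.

Definition in_cell (a b : nat) (r : 'I_n) : bool :=
  [&& nth 0 index_lines a < r.+1 < nth 0 index_lines a.+1
    & nth 0 value_lines b < (s r).+1 < nth 0 value_lines b.+1].

Definition increasing_choice : bool :=
  [forall j : 'I_m, forall k : 'I_m, (j < k) ==> (f j < f k)].

Definition order_isomorphic : bool :=
  [forall j : 'I_m, forall k : 'I_m,
     (s (f j) < s (f k)) == (mesh_perm p j < mesh_perm p k)].

Definition is_occurrence : bool :=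
  [&& increasing_choice, order_isomorphic
    & [forall c in mesh_shading p, forall r : 'I_n, ~~ in_cell c.1 c.2 r]].

End Occurrences.

Definition occurrences (m n : nat) (p : mesh_pattern m) (s : 'S_n) : nat :=
  #|[set f : {ffun 'I_m -> 'I_n} | is_occurrence p s f]|.

Definition shading_R : {set 'I_4 * 'I_4} :=
  [set c : 'I_4 * 'I_4 |
     (val c.1, val c.2) \in
       [:: (0, 0); (0, 1); (2, 0); (2, 1); (2, 3); (3, 0); (3, 1); (3, 3)]].

(* 123 is the identity; 132 exchanges the last two of the positions 0, 1, 2. *)
Definition P3 : mesh_pattern 3 := @MeshPattern 3 1%g shading_R.

Definition P4 : mesh_pattern 3 :=
  @MeshPattern 3 (tperm (@Ordinal 3 1 isT) (@Ordinal 3 2 isT)) shading_R.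

(* Main.v *)
Require Import Defs.
From mathcomp Require Import all_boot all_fingroup zify.
Set Implicit Arguments.
Unset Strict Implicit.
Unset Printing Implicit Defensive.

(** Let (x, y, z) be the positions of an occurrence of either pattern, with
    lo < hi the values at y and z in increasing order.  The shading in columns
    2 and 3 says that every value to the right of y, other than the one at z,
    lies between lo and hi; the shading in column 0 says that x is the first
    position carrying a value below lo.  Hence y determines the occurrence: z
    is the position of the maximum (for 123) or minimum (for 132) of the suffix
    starting at y, and x is determined by lo.  For 123 the entry at y is then a
    right-to-left minimum, for 132 a right-to-left maximum.  Conversely, such a
    y that is not the last position comes from an occurrence exactly when some
    value below lo stands to the left of y, that is, when the least value of the
    permutation stands to the left of y.  So the two numbers of occurrences
    count the non-last right-to-left minima, respectively maxima, located
    after the least value ([occurrences_late]).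

    Both counts depend only on the relative order of the entries after the
    least value.  Complementing these entries within their own set of values
    ([flip]) is an involution of the symmetric group that exchanges
    right-to-left minima and maxima there, hence exchanges the two counts
    ([occurrences_flip]); it maps one of the two sets onto the other. *)

(** * Occurrences of the two patterns *)

(** The boolean selects between the two mirror-image cases, so that minima and
    maxima are treated at once: [true] is the pattern 123, whose second entry is
    below its third one, and [false] is 132. *)
Definition strict (up : bool) (u v : nat) := if up then u < v else v < u.
Definition pattern (up : bool) := if up then P3 else P4.

Notation i0 := (@Ordinal 3 0 isT).
Notation i1 := (@Ordinal 3 1 isT).
Notation i2 := (@Ordinal 3 2 isT).

Lemma enum_ord3 : enum 'I_3 = [:: i0; i1; i2].
Proof. by apply: (inj_map val_inj); rewrite val_enum_ord. Qed.

(** Turns the shading condition into one condition per shaded cell. *)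
Lemma shading_RP (P : nat -> nat -> bool) :
  [forall c in shading_R, P (val c.1) (val c.2)] =
  all (fun ab => P ab.1 ab.2)
    [:: (0, 0); (0, 1); (2, 0); (2, 1); (2, 3); (3, 0); (3, 1); (3, 3)].
Proof.
apply/forall_inP/allP => [H [a b] ab | H [a b]]; last first.
  by rewrite inE => /H.
have [a4 b4] : a < 4 /\ b < 4.
  by move: ab; rewrite !inE => /or4P[||| /or4P[||| /orP[]]] /eqP[-> ->].
by apply: (H (Ordinal a4, Ordinal b4)); rewrite inE.
Qed.

Lemma sort3 a b c : a < b -> b < c ->
  sort leq [:: a; b; c] = [:: a; b; c] /\ sort leq [:: a; c; b] = [:: a; b; c].
Proof.
move=> ab bc; split; apply: (sorted_eq leq_trans anti_leq);
  rewrite ?(sort_sorted leq_total) //= ?(ltnW ab) ?(ltnW bc) // perm_sort //.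
by rewrite perm_cons (perm_catC [:: c] [:: b]).
Qed.

Section Occ.
Variables (n : nat) (s : 'S_n).

(** The meaning of an occurrence at the positions x < y < z: the entries at y and
    z are the two extreme values of the suffix starting at y, and x is the first
    position of a value below both of them. *)
Definition anchored (up : bool) (x y z : 'I_n) : Prop :=
  [/\ x < y < z,
      s x < minn (s y) (s z),
      forall r : 'I_n, r < x -> minn (s y) (s z) <= s r,
      forall r : 'I_n, y < r -> strict up (s y) (s r)
    & forall r : 'I_n, y <= r -> r != z -> strict up (s r) (s z)].

Lemma forall3 (P : pred 'I_3) : [forall j, P j] = [&& P i0, P i1 & P i2].
Proof.
apply/forallP/and3P => [H | [H0 H1 H2] [[|[|[|//]]] lt3]]; first by split.
- by rewrite (_ : Ordinal _ = i0) //; apply: val_inj.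
- by rewrite (_ : Ordinal _ = i1) //; apply: val_inj.
- by rewrite (_ : Ordinal _ = i2) //; apply: val_inj.
Qed.

(** A shaded cell has open sides, so it leaves out the entries of the occurrence
    itself; injectivity of s accounts for these boundary cases. *)
Lemma is_occurrenceP (up : bool) (f : {ffun 'I_3 -> 'I_n}) :
  reflect (anchored up (f i0) (f i1) (f i2)) (is_occurrence (pattern up) s f).
Proof.
have shE : mesh_shading (pattern up) = shading_R by case: up.
rewrite /is_occurrence shE.
rewrite (shading_RP (fun a b => [forall r, ~~ in_cell s f a b r])).
have -> : increasing_choice f = (f i0 < f i1 < f i2).
  by rewrite /increasing_choice !forall3 /=; lia.
have -> : order_isomorphic (pattern up) s f =
   [&& s (f i0) < minn (s (f i1)) (s (f i2)) & strict up (s (f i1)) (s (f i2))].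
  rewrite /order_isomorphic !forall3 /=.
  by case: up {shE}; rewrite /= ?perm1 ?permE /=; lia.
set x := f i0; set y := f i1; set z := f i2.
have ixE : index_lines f = [:: 0; x.+1; y.+1; z.+1; n.+1].
  by rewrite /index_lines enum_ord3.
have viE : s x < minn (s y) (s z) -> strict up (s y) (s z) ->
  value_lines s f = [:: 0; (s x).+1; (minn (s y) (s z)).+1;
                        (maxn (s y) (s z)).+1; n.+1].
  move=> lo; rewrite /value_lines enum_ord3 /= -/x -/y -/z.
  case: (up) => /= cmp.
  - by rewrite (sort3 _ _).1 /=; do 4?f_equal; lia.
  - by rewrite (sort3 _ _).2 /=; do 4?f_equal; lia.
have sI (r t : 'I_n) : s r = s t :> nat -> r = t by move/val_inj/perm_inj.
apply: (iffP and3P) => [[xyz /andP[lo cmp]] | [xyz lo Hx Hy Hz]].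
  rewrite /in_cell ixE (viE lo cmp) /=.
  move=> /and5P[/forallP c00 /forallP c01 /forallP c20 /forallP c21].
  move=> /and5P[/forallP c23 /forallP c30 /forallP c31 /forallP c33 _].
  have aft (r : 'I_n) : y < r -> r != z -> minn (s y) (s z) < s r < maxn (s y) (s z).
    move=> yr rz.
    have rz' : r <> z :> nat by move/val_inj=> rz'; rewrite rz' eqxx in rz.
    have e1 : s r <> s x :> nat by move/sI=> rx; move: yr; rewrite rx; lia.
    have e2 : s r <> s y :> nat by move/sI=> ry; move: yr; rewrite ry; lia.
    have e3 : s r <> s z :> nat by move/sI=> rz''; rewrite rz'' in rz'.
    move: (c20 r) (c21 r) (c23 r) (c30 r) (c31 r) (c33 r) (ltn_ord r) (ltn_ord (s r)) => *; lia.
  split=> // r.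
  - move=> rx.
    have e1 : s r <> s x :> nat by move/sI=> rx'; move: rx; rewrite rx'; lia.
    by move: (c00 r) (c01 r); lia.
  - move=> yr; have [-> //|rz] := eqVneq r z.
    by move: (aft r yr rz) cmp; case: (up) => /=; lia.
  - rewrite leq_eqVlt => /predU1P[/val_inj <- //|yr rz].
    by move: (aft r yr rz) cmp; case: (up) => /=; lia.
have cmp : strict up (s y) (s z) by apply: Hy; case/andP: xyz.
split=> //; first by rewrite lo.
rewrite /in_cell ixE (viE lo cmp) /=.
have aft (r : 'I_n) : y < r -> r = z \/ minn (s y) (s z) < s r < maxn (s y) (s z).
  move=> yr; have [->|rz] := eqVneq r z; first by left.
  right; move: (Hy r yr) (Hz r (ltnW yr) rz) cmp; case: (up) => /=; lia.
do ?[apply/andP; split] => //; apply/forallP=> r.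
1,2: by move: (Hx r); lia.
all: have [yr|] := ltnP y r; [case: (aft r yr) => [->|]|]; lia.
Qed.

End Occ.

(** * Counting occurrences by their middle position *)

Section Count.
Variables (n : nat) (s : 'S_n.+1).

Definition min_pos : 'I_n.+1 := (s^-1%g) ord0.

(** With positions numbered from 0, [y < n] excludes the last position: the
    third entry of an occurrence needs room to the right of y. *)
Definition late_records (up : bool) : {set 'I_n.+1} :=
  [set y : 'I_n.+1 | [&& min_pos < y, y < n
    & [forall r : 'I_n.+1, (y < r) ==> strict up (s y) (s r)]]].

Lemma min_posE : s min_pos = ord0.
Proof. by rewrite permKV. Qed.

Lemma value_gt0 r : (0 < s r) = (r != min_pos).
Proof. by rewrite lt0n -(inj_eq (@perm_inj _ s)) min_posE. Qed.

(** If the least value stood at or after y, it would belong to the suffix whose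
    minimum is the smaller of the entries at y and z; nothing could then be below
    that minimum, although the entry at x is. *)
Lemma anchored_late (up : bool) x y z : anchored s up x y z -> y \in late_records up.
Proof.
case=> xyz lo Hx Hy Hz; rewrite inE; apply/and3P; split;
  [ | by move: xyz (ltn_ord z); lia | by apply/forall_inP=> r; apply: Hy].
rewrite ltnNge; apply/negP=> yp.
have sy0 : 0 < s y by lia.
have sz0 : 0 < s z by lia.
have yp' : y < min_pos.
  by rewrite ltn_neqAle yp andbT; move: sy0; rewrite value_gt0.
have := Hy _ yp'; have := Hz _ yp; rewrite min_posE /= eq_sym -value_gt0 sz0.
by case: up {Hy Hz} => /= [|/(_ isT)]; rewrite ltn0.
Qed.

(** The suffix starting at y has a single opposite extreme z, and then x is the
    first position of a value below a known bound. *)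
Lemma anchored_uniq (up : bool) x y z x' z' :
  anchored s up x y z -> anchored s up x' y z' -> x = x' /\ z = z'.
Proof.
case=> xyz lo Hx Hy Hz [xyz' lo' Hx' Hy' Hz'].
have zz : z = z'.
  apply/eqP/negPn/negP=> zz; have := Hz z'; have := Hz' z.
  rewrite zz eq_sym zz => /(_ _ isT) H1 /(_ _ isT) H2.
  by move: H1 H2; case: up {Hy Hz Hy' Hz'} => /=; lia.
split=> //; subst z'; apply: val_inj; apply/eqP; rewrite eqn_leq.
by apply/andP; split; rewrite leqNgt; apply/negP; [move/Hx|move/Hx']; lia.
Qed.

(** Take for z the position of the opposite extreme of the suffix; the least value
    lies below both extremes and stands to the left of y, so the first position x
    of such a small value is to the left of y too. *)
Lemma anchored_exists (up : bool) y :
  y \in late_records up -> exists x z, anchored s up x y z.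
Proof.
rewrite inE => /and3P[py yn /forall_inP Hy].
have [z yz Hz] : exists2 z : 'I_n.+1, y <= z
    & forall r : 'I_n.+1, y <= r -> r != z -> strict up (s r) (s z).
  have ne (r z : 'I_n.+1) : r != z -> s r != s z :> nat.
    by rewrite (inj_eq val_inj) (inj_eq perm_inj).
  case: (up).
  - case: (@arg_maxnP _ y (fun z => y <= z) (fun z => val (s z))) => // z yz Hz.
    by exists z => // r /Hz /= le /ne; lia.
  - case: (@arg_minnP _ y (fun z => y <= z) (fun z => val (s z))) => // z yz Hz.
    by exists z => // r /Hz /= le /ne; lia.
(* If z were y, the entry at y would be both extremes of a suffix that
   contains the last position as well. *)
have yz' : y < z.
  rewrite ltn_neqAle yz andbT; apply/eqP=> /val_inj eyz.
  have := Hz ord_max; have := Hy ord_max; rewrite -eyz.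
  rewrite -(inj_eq val_inj) /= (gtn_eqF yn) => /(_ yn) + /(_ (ltnW yn) isT).
  by case: (up) => /=; lia.
have p_lo : s min_pos < minn (s y) (s z).
  rewrite min_posE /= leq_min !value_gt0 -!(inj_eq val_inj) /=.
  by rewrite !gtn_eqF // (ltn_trans py).
case: (@arg_minnP _ min_pos (fun x => s x < minn (s y) (s z)) val) => //=.
move=> x lo Hx; exists x, z; split=> //.
- by rewrite (leq_ltn_trans (Hx _ p_lo)).
- by move=> r rx; rewrite leqNgt; apply/negP=> /Hx; rewrite leqNgt rx.
Qed.

(** Occurrences correspond to late records through their middle position. *)
Lemma occurrences_late (up : bool) : occurrences (pattern up) s = #|late_records up|.
Proof.
rewrite /occurrences; set O := [set f | _].
have occP f : f \in O -> anchored s up (f i0) (f i1) (f i2).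
  by rewrite inE => /is_occurrenceP.
have inj : {in O &, injective (fun f : {ffun 'I_3 -> 'I_n.+1} => f i1)}.
  move=> f g /occP + /occP + fg; rewrite fg => af ag.
  have [e0 e2] := anchored_uniq af ag.
  apply/ffunP=> j; apply/eqP; move: j; apply/forallP.
  by rewrite forall3 e0 e2 fg !eqxx.
rewrite -(card_in_imset inj); apply: eq_card => y; apply/imsetP/idP.
  by case=> f /occP + ->; apply: anchored_late.
case/anchored_exists=> x [z axyz].
exists [ffun j : 'I_3 => nth x [:: x; y; z] j]; last by rewrite ffunE.
by rewrite inE; apply/is_occurrenceP; rewrite !ffunE.
Qed.
End Count.

(** * The order-reversing involution of a set of values *)

Section Reversal.
Variables (n : nat) (V : {set 'I_n}).

(** Exchanges the i-th smallest and the i-th largest element of V.  Outside V the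
    index is out of range, and the default of [nth] makes the map the identity. *)
Definition rev_val (v : 'I_n) := nth v (rev (enum V)) (index v (enum V)).

Lemma rev_val_id v : v \notin V -> rev_val v = v.
Proof.
rewrite -mem_enum => vV; rewrite /rev_val nth_default // size_rev.
by rewrite (memNindex vV).
Qed.

Lemma rev_valE v : v \in V ->
  rev_val v = nth v (enum V) (#|V| - (index v (enum V)).+1).
Proof.
by move=> vV; rewrite /rev_val nth_rev -?cardE // cardE index_mem mem_enum.
Qed.

Lemma mem_rev_val v : (rev_val v \in V) = (v \in V).
Proof.
have [vV|vV] := boolP (v \in V); last by rewrite rev_val_id // (negPf vV).
by rewrite -mem_enum -mem_rev mem_nth // size_rev index_mem mem_enum.
Qed.

Lemma rev_valK : involutive rev_val.
Proof.
move=> v; have [vV|vV] := boolP (v \in V); last by rewrite !rev_val_id.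
have iv : index v (enum V) < #|V| by rewrite cardE index_mem mem_enum.
rewrite rev_valE ?mem_rev_val //.
have -> : index (rev_val v) (enum V) = #|V| - (index v (enum V)).+1.
  rewrite rev_valE // index_uniq ?enum_uniq // -cardE ltn_subrL.
  exact: leq_ltn_trans iv.
rewrite subnS subKn //.
by rewrite (set_nth_default v) ?nth_index ?mem_enum // -cardE.
Qed.

Lemma nth_enum_mono v i j : i < j -> j < #|V| ->
  nth v (enum V) i < nth v (enum V) j.
Proof.
have tr : transitive (fun u w : 'I_n => u < w).
  by move=> ? ? ?; apply: ltn_trans.
have srt : sorted (fun u w : 'I_n => u < w) (enum V).
  rewrite {1}/enum_mem; apply: (sorted_filter tr).
  by rewrite -enumT; have := iota_ltn_sorted 0 n; rewrite -val_enum_ord sorted_map.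
move=> ij jV; apply: (sorted_ltn_nth tr v srt) => //; rewrite inE -cardE //.
exact: ltn_trans ij jV.
Qed.

Lemma index_enum_mono (v w : 'I_n) : v \in V -> w \in V -> v < w ->
  index v (enum V) < index w (enum V).
Proof.
move=> vV wV vw; rewrite ltnNge leq_eqVlt; apply/negP=> /predU1P[ewv|].
  have := congr1 (nth v (enum V)) ewv.
  by rewrite !nth_index ?mem_enum // => wv; move: vw; rewrite wv ltnn.
move/(nth_enum_mono v); rewrite cardE index_mem mem_enum vV => /(_ isT).
by rewrite !nth_index ?mem_enum // ltnNge (ltnW vw).
Qed.

Lemma rev_val_anti (v w : 'I_n) : v \in V -> w \in V -> v < w -> rev_val w < rev_val v.
Proof.
move=> vV wV vw; have iw : index w (enum V) < #|V|.
  by rewrite cardE index_mem mem_enum.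
have ivw := index_enum_mono vV wV vw; have V0 := leq_ltn_trans (leq0n _) iw.
rewrite !rev_valE // (set_nth_default v w) -?cardE ?ltn_subrL ?V0 //.
by apply: nth_enum_mono; rewrite ?ltn_subrL ?V0 // ltn_sub2l // (leq_trans _ iw).
Qed.

Definition rev_perm : 'S_n := perm (inv_inj rev_valK).
End Reversal.

(** * Complementing the entries after the least value *)

Section Flip.
Variable n : nat.
Implicit Type s : 'S_n.+1.

Definition late_values s : {set 'I_n.+1} := [set s j | j : 'I_n.+1 & min_pos s < j].

Lemma mem_late_values s j : (s j \in late_values s) = (min_pos s < j).
Proof. by rewrite mem_imset ?inE //; apply: perm_inj. Qed.

Definition flip s : 'S_n.+1 := (s * rev_perm (late_values s))%g.

Lemma flipE s j : flip s j = rev_val (late_values s) (s j).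
Proof. by rewrite permM permE. Qed.

(** The least value is not among the late values, so it stays in place; this makes
    the set of late values invariant, hence [flip] an involution. *)
Lemma min_pos_flip s : min_pos (flip s) = min_pos s.
Proof.
apply: (@perm_inj _ (flip s)); rewrite min_posE flipE min_posE rev_val_id //.
by rewrite -(min_posE s) mem_late_values ltnn.
Qed.

Lemma late_values_flip s : late_values (flip s) = late_values s.
Proof.
apply/setP=> v; rewrite -(permKV (flip s) v) mem_late_values min_pos_flip.
by rewrite flipE mem_rev_val mem_late_values.
Qed.

Lemma flipK : involutive flip.
Proof.
by move=> s; apply/permP=> j; rewrite flipE late_values_flip flipE rev_valK.
Qed.

(** All values compared in a late record are late, and [rev_val] reverses the
    order of the late values. *)
Lemma late_records_flip s (up : bool) : late_records (flip s) up = late_records s (~~ up).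
Proof.
apply/setP=> y; rewrite !inE min_pos_flip; case: ltnP => //= py.
congr (_ && _); apply: eq_forallb_in => r yr.
have yV : s y \in late_values s by rewrite mem_late_values.
have rV : s r \in late_values s by rewrite mem_late_values (ltn_trans py).
rewrite !flipE; set c := rev_val _.
have cE : (c (s y) < c (s r)) = (s r < s y).
  case: (ltngtP (s r) (s y)) => [|/(rev_val_anti yV rV)|/val_inj ->]; last by rewrite ltnn.
    by move/(rev_val_anti rV yV).
  by rewrite -/c; lia.
have cE' : (c (s r) < c (s y)) = (s y < s r).
  case: (ltngtP (s y) (s r)) => [|/(rev_val_anti rV yV)|/val_inj ->]; last by rewrite ltnn.
    by move/(rev_val_anti yV rV).
  by rewrite -/c; lia.
by case: up.
Qed.

Lemma occurrences_flip s (up : bool) :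
  occurrences (pattern up) (flip s) = occurrences (pattern (~~ up)) s.
Proof. by rewrite !occurrences_late late_records_flip. Qed.
End Flip.

Theorem mainTheorem2 (n k l : nat) (n_ge1 : 1 <= n) :
  #|[set s : 'S_n | (occurrences P3 s == k) && (occurrences P4 s == l)]| =
  #|[set s : 'S_n | (occurrences P4 s == k) && (occurrences P3 s == l)]|.
Proof.
case: n n_ge1 => // n _.
rewrite -(card_preimset _ (inv_inj (@flipK n))); apply: eq_card => s.
by rewrite !inE (occurrences_flip s true) (occurrences_flip s false).
Qed.
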